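(* Let $m>2$. The Dirac operator is not conformally invariant under inversion in the Rarita-Schwinger setting: there exists a function $f:\mathbb{R}^m\times\mathbb{R}^m\to\mathcal{C}l_m$, $(x,u)\mapsto f(x,u)$, polynomial in $u$ for each fixed $x$, with $D_xf(x,u)=D_uf(x,u)=0$, such that $$D_y\Big[\frac{y}{\|y\|^m}\,f\Big(y^{-1},\frac{ywy}{\|y\|^2}\Big)\Big]$$ is not identically zero as a function of $y\in\mathbb{R}^m\setminus\{0\}$ and $w\in\mathbb{R}^m$. Specifically, $f(x,u)=u_1e_1-u_2e_2$ is such a function, and for it $$D_y\Big[\frac{y}{\|y\|^m}\,f\Big(y^{-1},\frac{ywy}{\|y\|^2}\Big)\Big]=\frac{-2wy(y_1e_1-y_2e_2)}{\|y\|^{m+2}}.$$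
   Context: $\mathcal{C}l_m$ is the real Clifford algebra generated by $\mathbb{R}^m$ with orthonormal basis $e_1,\dots,e_m$ and relations $e_ie_j+e_je_i=-2\delta_{ij}$; $\mathbb{R}^m$ is regarded as a subset of $\mathcal{C}l_m$ via $x=\sum_i x_ie_i$, and products such as $ywy$ are Clifford products (so $ywy\in\mathbb{R}^m$ for $y,w\in\mathbb{R}^m$). For a nonzero vector $y$, $y^{-1}=-y/\|y\|^2$ is its inverse in $\mathcal{C}l_m$. The Dirac operator in a variable $x\in\mathbb{R}^m$ is $D_x=\sum_{i=1}^m e_i\partial_{x_i}$, acting by Clifford multiplication from the left. *)

(* Defs.v *)
From HB Require Import structures.
From mathcomp Require Import all_boot all_order all_algebra.
From mathcomp Require Import boolp classical_sets reals topology normedtype derive.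
From mathcomp Require Import ring.
From mathcomp Require mpoly.

Set Implicit Arguments.
Unset Strict Implicit.
Unset Printing Implicit Defensive.

Import Order.TTheory GRing.Theory Num.Theory.
Import numFieldNormedType.Exports.
Local Open Scope ring_scope.

(* The coordinates of a Clifford number are indexed by the subsets A of 'I_m;
   A stands for the product e_{i_1} ... e_{i_k}, where A = {i_1 < ... < i_k}
   (see clbladeE below). Being a copy of a space of row vectors, the algebra
   inherits a normed space structure, used only through its topology. *)
Definition clifford (R : realType) (m : nat) : Type := 'rV[R]_#|{set 'I_m}|.

HB.instance Definition _ (R : realType) (m : nat) :=
  NormedModule.copy (clifford R m) 'rV[R]_#|{set 'I_m}|.

Section CliffordAlgebra.
Variables (R : realType) (m : nat).
Local Notation Cl := (clifford R m).
Implicit Types (A B C D : {set 'I_m}) (a b c : Cl) (i j : 'I_m).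

Definition clcoef a A : R := (a : 'rV[R]__) 0 (enum_rank A).

Definition clblade A : Cl := (delta_mx 0 (enum_rank A) : 'rV[R]__).

Definition symdiff A B : {set 'I_m} := (A :\: B) :|: (B :\: A).

(* Reordering e_A e_B costs one sign for each pair i \in A, j \in B with j < i
   (as e_i e_j = - e_j e_i) and one for each i = j (as e_i e_i = - 1). *)
Definition clsign A B : R := (-1) ^+ (\sum_(i in A) \sum_(j in B) (j <= i)%N).

Definition clmul a b : Cl :=
  \sum_A \sum_B (clcoef a A * clcoef b B * clsign A B) *: clblade (symdiff A B).

Lemma clcoefP a b : (forall A, clcoef a A = clcoef b A) -> a = b.
Proof.
move=> ab; apply/rowP => k; have := ab (enum_val k).
by rewrite /clcoef enum_valK.
Qed.

Lemma clcoefD a b A : clcoef (a + b) A = clcoef a A + clcoef b A.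
Proof. by rewrite /clcoef !mxE. Qed.

Lemma clcoefZ (k : R) a A : clcoef (k *: a) A = k * clcoef a A.
Proof. by rewrite /clcoef !mxE. Qed.

Lemma clcoef0 A : clcoef 0 A = 0.
Proof. by rewrite /clcoef !mxE. Qed.

Lemma clcoef_sum (I : finType) (P : pred I) (F : I -> Cl) A :
  clcoef (\sum_(k | P k) F k) A = \sum_(k | P k) clcoef (F k) A.
Proof.
exact: (big_morph (fun a => clcoef a A) (fun a b => clcoefD a b A) (clcoef0 A)).
Qed.

Lemma clcoef_blade A B : clcoef (clblade A) B = (A == B)%:R.
Proof. by rewrite /clcoef !mxE eqxx/= (inj_eq enum_rank_inj) eq_sym. Qed.

Lemma clifford_sum_blade a : a = \sum_A clcoef a A *: clblade A.
Proof.
apply: clcoefP => B; rewrite clcoef_sum (bigD1 B)//= big1 => [|A AB].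
  by rewrite clcoefZ clcoef_blade eqxx mulr1 addr0.
by rewrite clcoefZ clcoef_blade (negbTE AB) mulr0.
Qed.

Lemma symdiffA A B C : symdiff A (symdiff B C) = symdiff (symdiff A B) C.
Proof.
by apply/setP => i; rewrite !inE; case: (i \in A); case: (i \in B); case: (i \in C).
Qed.

Lemma symdiff0 A : symdiff A finset.set0 = A.
Proof. by apply/setP => i; rewrite !inE; case: (i \in A). Qed.

Lemma sym0diff A : symdiff finset.set0 A = A.
Proof. by apply/setP => i; rewrite !inE; case: (i \in A). Qed.

Lemma symdiffK A B : symdiff A (symdiff A B) = B.
Proof. by apply/setP => i; rewrite !inE; case: (i \in A); case: (i \in B). Qed.

Lemma symdiff_eq A B C : (symdiff A B == C) = (B == symdiff A C).
Proof. by apply/eqP/eqP => [<-|->]; rewrite symdiffK. Qed.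

Lemma clsignE A B :
  clsign A B = \prod_(i in A) \prod_(j in B) (-1) ^+ (j <= i)%N.
Proof.
rewrite /clsign -prodrXr; apply: eq_bigr => i _; by rewrite -prodrXr.
Qed.

Lemma prod_symdiff (F : 'I_m -> R) A B : (forall i, F i * F i = 1) ->
  \prod_(i in symdiff A B) F i = (\prod_(i in A) F i) * \prod_(i in B) F i.
Proof.
move=> FF; rewrite !(big_mkcond (fun i => i \in _)) -big_split; apply: eq_bigr => i _ /=.
by rewrite !inE; case: (i \in A); case: (i \in B); rewrite /= ?(mulr1, mul1r, FF).
Qed.

Lemma clsign_symdiffl A B C : clsign (symdiff A B) C = clsign A C * clsign B C.
Proof.
rewrite !clsignE prod_symdiff// => i; rewrite -big_split big1//= => j _.
by rewrite -expr2 sqrr_sign.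
Qed.

Lemma clsign_symdiffr A B C : clsign A (symdiff B C) = clsign A B * clsign A C.
Proof.
rewrite !clsignE -big_split; apply: eq_bigr => i _.
by rewrite prod_symdiff// => j; rewrite -expr2 sqrr_sign.
Qed.

Lemma clcoef_mul a b C : clcoef (clmul a b) C =
  \sum_A clcoef a A * clcoef b (symdiff A C) * clsign A (symdiff A C).
Proof.
rewrite /clmul clcoef_sum; apply: eq_bigr => A _; rewrite clcoef_sum.
rewrite (bigD1 (symdiff A C))//= big1 => [|B BAC].
  by rewrite clcoefZ clcoef_blade symdiffK eqxx mulr1 addr0.
by rewrite clcoefZ clcoef_blade symdiff_eq (negbTE BAC) mulr0.
Qed.

Lemma clmulA : associative clmul.
Proof.
move=> a b c; apply: clcoefP => D; rewrite !clcoef_mul.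
under eq_bigr do rewrite clcoef_mul mulr_sumr mulr_suml.
under [RHS]eq_bigr do rewrite clcoef_mul !mulr_suml.
rewrite [RHS]exchange_big; apply: eq_bigr => A _ /=.
rewrite [RHS](reindex_onto (symdiff A) (symdiff A)) => [|B _]; last exact: symdiffK.
under [RHS]eq_bigl do rewrite symdiffK eqxx.
apply: eq_bigr => B _; rewrite symdiffK.
have -> : symdiff (symdiff A B) D = symdiff B (symdiff A D).
  by apply/setP => i; rewrite !inE; case: (i \in A); case: (i \in B); case: (i \in D).
rewrite clsign_symdiffl.
have -> : clsign A (symdiff A D) = clsign A B * clsign A (symdiff B (symdiff A D)).
  by rewrite -clsign_symdiffr symdiffK.
by ring.
Qed.

Lemma clsign0 A : clsign A finset.set0 = 1.
Proof. by rewrite clsignE big1// => i _; rewrite big_set0. Qed.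

Lemma clsign0s A : clsign finset.set0 A = 1.
Proof. by rewrite clsignE big_set0. Qed.

Lemma clmul1l : left_id (clblade finset.set0) clmul.
Proof.
move=> a; apply: clcoefP => C; rewrite clcoef_mul (bigD1 finset.set0)//= big1 => [|A A0].
  by rewrite clcoef_blade eqxx mul1r sym0diff clsign0s mulr1 addr0.
by rewrite clcoef_blade eq_sym (negbTE A0) !mul0r.
Qed.

Lemma clmul1r : right_id (clblade finset.set0) clmul.
Proof.
move=> a; apply: clcoefP => C; rewrite clcoef_mul (bigD1 C)//= big1 => [|A AC].
  have -> : symdiff C C = finset.set0 by apply/setP => i; rewrite !inE; case: (i \in C).
  by rewrite clcoef_blade eqxx clsign0 !mulr1 addr0.
rewrite clcoef_blade [_ == _](_ : _ = false) ?mulr0 ?mul0r//.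
apply: contra_neqF AC => /eqP AC0; apply/eqP.
by rewrite -(symdiffK A C) -AC0 symdiff0.
Qed.

Lemma clmulDl : left_distributive clmul +%R.
Proof.
move=> a b c; apply: clcoefP => C; rewrite clcoefD !clcoef_mul -big_split.
by apply: eq_bigr => A _; rewrite clcoefD/= !mulrDl.
Qed.

Lemma clmulDr : right_distributive clmul +%R.
Proof.
move=> a b c; apply: clcoefP => C; rewrite clcoefD !clcoef_mul -big_split.
by apply: eq_bigr => A _; rewrite clcoefD/= mulrDr mulrDl.
Qed.

Lemma clone_neq0 : clblade finset.set0 != 0.
Proof.
apply/eqP => /(congr1 (clcoef^~ finset.set0)) /eqP.
by rewrite clcoef_blade eqxx clcoef0 oner_eq0.
Qed.

Lemma clmulZl (k : R) a b : k *: clmul a b = clmul (k *: a) b.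
Proof.
apply: clcoefP => C; rewrite clcoefZ !clcoef_mul mulr_sumr.
by apply: eq_bigr => A _; rewrite clcoefZ !mulrA.
Qed.

Lemma clmulZr (k : R) a b : k *: clmul a b = clmul a (k *: b).
Proof.
apply: clcoefP => C; rewrite clcoefZ !clcoef_mul mulr_sumr.
by apply: eq_bigr => A _; rewrite clcoefZ; ring.
Qed.

End CliffordAlgebra.

HB.instance Definition _ (R : realType) (m : nat) :=
  GRing.Zmodule_isNzRing.Build (clifford R m)
    (@clmulA R m) (@clmul1l R m) (@clmul1r R m)
    (@clmulDl R m) (@clmulDr R m) (@clone_neq0 R m).

HB.instance Definition _ (R : realType) (m : nat) :=
  GRing.Lmodule_isLalgebra.Build R (clifford R m) (@clmulZl R m).

HB.instance Definition _ (R : realType) (m : nat) :=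
  GRing.Lalgebra_isAlgebra.Build R (clifford R m) (@clmulZr R m).

Section Vectors.
Variables (R : realType) (m : nat).
Local Notation Cl := (clifford R m).
Implicit Types (A B C : {set 'I_m}) (a b c : Cl) (i j : 'I_m) (x y w : 'rV[R]_m).

Definition cle i : Cl := clblade R [set i]%SET.

Definition clvec x : Cl := \sum_i x 0 i *: cle i.

Definition clvecpart a : 'rV[R]_m := \row_i clcoef a [set i]%SET.

(* Norms provided by the library on 'rV are sup norms. *)
Definition dotp x y : R := \sum_i x 0 i * y 0 i.

Definition enorm x : R := Num.sqrt (dotp x x).

Definition vecinv y : 'rV[R]_m := - (enorm y ^+ 2)^-1 *: y.

(* The vector y w y. *)
Definition sandwich y w : 'rV[R]_m := clvecpart (clvec y * clvec w * clvec y).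

Lemma clblade_mul A B :
  clblade R A * clblade R B = clsign R A B *: clblade R (symdiff A B).
Proof.
apply: clcoefP => C; rewrite clcoef_mul clcoefZ clcoef_blade.
rewrite (bigD1 A)//= big1 => [|D DA]; last first.
  by rewrite clcoef_blade eq_sym (negbTE DA) !mul0r.
rewrite !clcoef_blade eqxx mul1r addr0 symdiff_eq.
have [->|_] := eqVneq; last by rewrite mul0r mulr0.
by rewrite mulr1 mul1r.
Qed.

Lemma cle_sqr i : cle i * cle i = -1.
Proof.
rewrite clblade_mul clsignE !big_set1 leqnn expr1 scaleN1r; congr (- clblade _ _).
by apply/setP => k; rewrite !inE; case: (k == i).
Qed.

Lemma cle_anticomm i j : i != j -> cle i * cle j = - (cle j * cle i).
Proof.
move=> ij; rewrite !clblade_mul !clsignE !big_set1 -scaleNr.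
congr (_ *: clblade _ _); last by apply/setP => k; rewrite !inE orbC.
have : i != j :> nat by [].
by case: (ltngtP i j); rewrite /= ?expr0 ?expr1 ?opprK.
Qed.

Lemma cle_relation i j : cle i * cle j + cle j * cle i = (- 2 * (i == j)%:R)%:A.
Proof.
have [->|ij] := eqVneq i j; last by rewrite (cle_anticomm ij) addNr mulr0 scale0r.
by rewrite cle_sqr mulr1 scaleNr scaler_nat mulr2n opprD.
Qed.

(* Together with clifford_sum_blade and cle_relation, this shows that clifford R m
   is generated by the e_i and has dimension 2 ^ m. *)
Lemma clbladeE A : clblade R A = \prod_(i <- enum A) cle i.
Proof.
have : sorted ltn (map val (enum A)).
  rewrite {1}/enum_mem -enumT; apply: (subseq_sorted ltn_trans) (iota_ltn_sorted 0 m).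
  by rewrite -val_enum_ord map_subseq// filter_subseq.
have {2}-> : A = [set i in enum A]%SET by apply/setP => i; rewrite inE mem_enum.
elim: (enum A) => [|i s IH] /=.
  move=> _; rewrite big_nil -[RHS]/(clblade R finset.set0).
  by congr (clblade _ _); apply/setP => i; rewrite !inE.
rewrite (path_sortedE ltn_trans) => /andP[/allP si /IH ss].
have {}si j : j \in s -> (i < j)%N by move=> js; apply: si; exact: (map_f val).
have /negbTE iNs : i \notin s by apply/negP => /si; rewrite ltnn.
rewrite big_cons -ss clblade_mul clsignE big_set1 big1 ?scale1r => [|j].
  congr (clblade _ _); apply/setP => j; rewrite !inE.
  by have [->|_] := eqVneq j i; rewrite /= ?iNs ?andbF ?orbF ?andbT.
by rewrite inE => /si; rewrite ltnNge => /negbTE ->.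
Qed.

Lemma clvec_is_linear : linear clvec.
Proof.
move=> k x y; rewrite /clvec scaler_sumr -big_split; apply: eq_bigr => i _ /=.
by rewrite !mxE scalerDl scalerA.
Qed.

HB.instance Definition _ :=
  GRing.isLinear.Build R 'rV[R]_m (clifford R m) *:%R clvec clvec_is_linear.

Lemma clvecK : cancel clvec clvecpart.
Proof.
move=> x; apply/rowP => i; rewrite mxE clcoef_sum (bigD1 i)//= big1 => [|j ji].
  by rewrite clcoefZ clcoef_blade eqxx mulr1 addr0.
by rewrite clcoefZ clcoef_blade (inj_eq set1_inj) (negbTE ji) mulr0.
Qed.

Lemma clvec_relation x y :
  clvec x * clvec y + clvec y * clvec x = (- 2 * dotp x y)%:A.
Proof.
have E u v : clvec u * clvec v = \sum_i \sum_j (u 0 i * v 0 j) *: (cle i * cle j).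
  rewrite mulr_suml; apply: eq_bigr => i _; rewrite mulr_sumr; apply: eq_bigr => j _.
  by rewrite -scalerAl -scalerAr scalerA.
rewrite !E [X in _ + X]exchange_big -big_split/= /dotp mulr_sumr scaler_suml.
apply: eq_bigr => i _; rewrite -big_split/=.
under eq_bigr => j _ do rewrite [y 0 j * _]mulrC -scalerDr cle_relation.
rewrite (bigD1 i)//= big1 => [|j ji]; last by rewrite eq_sym (negbTE ji) mulr0 scale0r scaler0.
by rewrite eqxx mulr1 addr0 scalerA mulrC.
Qed.

Lemma enorm_sqr y : enorm y ^+ 2 = dotp y y.
Proof. by rewrite sqr_sqrtr// sumr_ge0// => i _; rewrite -expr2 sqr_ge0. Qed.

Lemma enorm_eq0 y : (enorm y == 0) = (y == 0).
Proof.
rewrite -(sqrf_eq0 (enorm y)) enorm_sqr psumr_eq0; last first.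
  by move=> i _; rewrite -expr2 sqr_ge0.
apply/allP/eqP => [y0|-> i _]; last by rewrite mxE mulr0 eqxx.
apply/rowP => i; rewrite mxE; apply/eqP; rewrite -sqrf_eq0 expr2.
by apply: y0; rewrite mem_index_enum.
Qed.

Lemma clvec_sqr y : clvec y * clvec y = (- enorm y ^+ 2)%:A.
Proof.
have := clvec_relation y y; rewrite -mulr2n -enorm_sqr => yy.
transitivity (2^-1 *: (clvec y * clvec y *+ 2)).
  by rewrite -(scaler_nat 2 (_ * _)) scalerA mulVf ?scale1r// pnatr_eq0.
by rewrite yy scalerA; congr (_ *: _); field.
Qed.

Lemma clvec_vecinv y : y != 0 -> clvec y * clvec (vecinv y) = 1.
Proof.
move=> y0; rewrite linearZ/= -scalerAr clvec_sqr scalerA mulrNN mulVf ?scale1r//.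
by rewrite expf_neq0// enorm_eq0.
Qed.

Lemma clvec_sandwich y w : clvec (sandwich y w) = clvec y * clvec w * clvec y.
Proof.
suff E : clvec y * clvec w * clvec y
    = clvec (enorm y ^+ 2 *: w - (2 * dotp y w) *: y) by rewrite /sandwich E clvecK.
have /(canRL (addrK _)) -> := clvec_relation y w.
rewrite mulrBl -mulrA clvec_sqr mulr_algl mulr_algr.
have -> k l x z : clvec (k *: x - l *: z) = k *: clvec x - l *: clvec z.
  by rewrite linearB !linearZ.
by rewrite mulNr !scaleNr opprK addrC.
Qed.

End Vectors.

Section Analysis.
Variables (R : realType) (m : nat).
Local Notation Cl := (clifford R m).

Definition dirac (f : 'rV[R]_m -> Cl) (x : 'rV[R]_m) : Cl :=
  \sum_i cle R i * 'D_(delta_mx 0 i) f x.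

(* dirac is a total operator: differentiability is required separately, so that
   the partial derivatives are genuine ones. *)
Definition monogenic (f : 'rV[R]_m -> Cl) : Prop :=
  forall x, differentiable f x /\ dirac f x = 0.

Definition polynomial_map (f : 'rV[R]_m -> Cl) : Prop :=
  exists p : {set 'I_m} -> mpoly.mpoly m R,
    forall u A, clcoef (f u) A = mpoly.meval (fun i => u 0 i) (p A).

Definition inversion (f : 'rV[R]_m -> 'rV[R]_m -> Cl) (w y : 'rV[R]_m) : Cl :=
  (enorm y ^+ m)^-1 *:
    (clvec y * f (vecinv y) ((enorm y ^+ 2)^-1 *: sandwich y w)).

(* For w fixed, inversion f w is required to be differentiable away from 0, so
   that dirac (inversion f w) is defined on all of R^m \ {0}. *)
Definition inversion_counterexample (f : 'rV[R]_m -> 'rV[R]_m -> Cl) : Prop :=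
  [/\ forall x, polynomial_map (f x),
      forall u, monogenic (f^~ u),
      forall x, monogenic (f x),
      forall w y, y != 0 -> differentiable (inversion f w) y
    & exists w y, y != 0 /\ dirac (inversion f w) y != 0].

End Analysis.

(* Main.v *)
Require Import Defs.
From HB Require Import structures.
From mathcomp Require Import all_boot all_order all_algebra.
From mathcomp Require Import boolp classical_sets functions reals topology normedtype derive.
From mathcomp Require Import sesquilinear realfun ring.
From mathcomp Require mpoly.
Import(canonicals) mpoly.

(** Write [tau u = u_1 e_1 - u_2 e_2], the gradient of the saddle
    [(u_1^2 - u_2^2) / 2]; it is monogenic, and constant in [x]. Since [y w y] is
    the vector [|y|^2 w - 2 (y.w) y], linearity of [tau] splits the transformed
    function into

      [|y|^-m y tau(w)  -  2 (y.w) |y|^-(m+2) y tau(y)].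

    The first summand is the fundamental solution [y / |y|^m] of the Dirac operator
    times a constant, so it is monogenic away from [0] ([dirac_kernel_const]). For
    the second, the Leibniz rule [D(k F) = (grad k) F + k D F] for scalar [k]
    ([dirac_scale]) is applied with [k = (w.y) |y|^-(m+2)]. The radial part of
    [grad k] contributes [(m+2) (w.y) |y|^-(m+2) tau(y)], because [y y = - |y|^2],
    and this cancels [k D(y tau(y)) = - (m+2) k tau(y)] ([dirac_clvec_saddle]). Only
    the gradient of [w.y] remains and gives [|y|^-(m+2) w y tau(y)]
    ([dirac_kernel_saddle]), whence the value [- 2 w y tau(y) / |y|^(m+2)]. It does
    not vanish at [w = y = e_1], where [w y tau(y) = e_1 e_1 e_1 = - e_1].

    Scalar functions are differentiated in the form [is_diff y k (dotp g)]: the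
    differential of [k] at [y] is the Euclidean product with [g], that is, [g] is
    the gradient of [k] at [y]. *)

Import Order.TTheory GRing.Theory Num.Theory.
Import numFieldNormedType.Exports.
Local Open Scope ring_scope.

Set Implicit Arguments.
Unset Strict Implicit.

(** * Differentials of bilinear and linear maps *)

Section Differentials.
Variable R : realType.
Implicit Types U V W : normedModType R.

Lemma is_diff_bilinear U V V' W (B : {bilinear V -> V' -> W})
    (f df : U -> V) (g dg : U -> V') (x : U) :
  continuous (fun p : V * V' => B p.1 p.2) ->
  is_diff x f df -> is_diff x g dg ->
  is_diff x (fun z => B (f z) (g z)) (fun h => B (f x) (dg h) + B (df h) (g x)).
Proof.
move=> cB fx gx.
have Bx : is_diff (f x, g x) (fun p => B p.1 p.2)
    (fun q => B (f x) q.2 + B q.1 (g x)).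
  apply: DiffDef; first exact: differentiable_bilin.
  by rewrite diff_bilin.
exact: (is_diff_comp (is_diff_pair fx gx) Bx).
Qed.

Lemma scale_is_bilinear V : bilinear_for *:%R *:%R (@GRing.scale R V).
Proof.
split=> [v|k] a x y /=; first by rewrite scalerDl scalerA.
by rewrite scalerDr !scalerA mulrC.
Qed.

Lemma is_diff_scale U V (k dk : U -> R) (f df : U -> V) (x : U) :
  is_diff x k dk -> is_diff x f df ->
  is_diff x (fun z => k z *: f z) (fun h => k x *: df h + dk h *: f x).
Proof.
pose BM := bilinear_isBilinear.Build R R V V *:%R *:%R *:%R (@scale_is_bilinear V).
pose B : {bilinear R -> V -> V} := HB.pack (@GRing.scale R V) BM.
by apply: (@is_diff_bilinear U _ _ _ B); apply: scale_continuous.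
Qed.

(** Continuity is automatic on a finite-dimensional space: in coordinates,
    [f z = \sum_i z_i f(e_i)]. *)
Lemma is_diff_linear_rV n V (f : 'rV[R]_n -> V) (x : 'rV[R]_n) :
  linear f -> is_diff x f f.
Proof.
move=> fL; pose fM := GRing.isLinear.Build R _ _ _ f fL.
pose F : {linear 'rV[R]_n -> V} := HB.pack f fM.
have cF : continuous F.
  have -> : F = (fun z => \sum_i z 0 i *: F (delta_mx 0 i)) :> (_ -> _).
    by apply/funext => z; rewrite {1}(row_sum_delta z) linear_sum;
       apply: eq_bigr => i _; rewrite linearZ.
  apply: (continuous_big (@add_continuous V)) => i _ z.
  by apply: continuousZr_tmp; exact: coord_continuous.
apply: DiffDef; first exact: (@linear_differentiable _ _ _ F).
by rewrite (@diff_lin _ _ _ F).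
Qed.

End Differentials.

Section CliffordCalculus.
Variables (R : realType) (m : nat).
Local Notation Cl := (clifford R m).
Implicit Types (x y w h : 'rV[R]_m) (c : Cl) (i : 'I_m).

(** * Vectors in the Clifford algebra *)

Lemma dotpC x y : dotp x y = dotp y x.
Proof. by apply: eq_bigr => i _; rewrite mulrC. Qed.

Lemma dotp_linear x : linear (dotp x : 'rV[R]_m -> R).
Proof.
move=> k y z; rewrite /dotp scaler_sumr -big_split; apply: eq_bigr => i _ /=.
by rewrite !mxE mulrDr mulrCA.
Qed.

Lemma dotpDl x y h : dotp (x + y) h = dotp x h + dotp y h.
Proof.
by have := dotp_linear h 1 x y; rewrite ![dotp h _]dotpC !scale1r.
Qed.

Lemma dotpZl (k : R) x h : dotp (k *: x) h = k * dotp x h.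
Proof. by rewrite /dotp mulr_sumr; apply: eq_bigr => i _; rewrite mxE mulrA. Qed.

Lemma dotp_delta x i : dotp x (delta_mx 0 i) = x 0 i.
Proof.
rewrite /dotp (bigD1 i)//= big1 => [|k ki]; last first.
  by rewrite mxE (negbTE ki) andbF mulr0.
by rewrite mxE !eqxx mulr1 addr0.
Qed.

Lemma clvec_delta i : clvec (delta_mx 0 i) = cle R i.
Proof.
rewrite /clvec (bigD1 i)//= big1 => [|k ki]; last first.
  by rewrite mxE (negbTE ki) andbF scale0r.
by rewrite mxE !eqxx scale1r addr0.
Qed.

Lemma enorm_gt0 y : y != 0 -> 0 < enorm y.
Proof. by move=> y0; rewrite lt_def enorm_eq0 y0 sqrtr_ge0. Qed.

Lemma enormVX2 n y :
  y != 0 -> (enorm y ^+ (n + 2))^-1 * enorm y ^+ 2 = (enorm y ^+ n)^-1.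
Proof.
move=> y0; have ny : enorm y != 0 by rewrite gt_eqF ?enorm_gt0.
by rewrite exprD; field; rewrite ny expf_neq0.
Qed.

Lemma clcoef_alg (k : R) : clcoef (k%:A : Cl) finset.set0 = k.
Proof. by rewrite clcoefZ [clcoef _ _]clcoef_blade eqxx mulr1. Qed.

(** Up to the factor [- |y|^2], this is the reflection of [w] in the hyperplane
    orthogonal to [y]. *)
Lemma sandwichE y w : sandwich y w = enorm y ^+ 2 *: w - (2 * dotp y w) *: y.
Proof.
apply: (can_inj (@clvecK R m)); rewrite clvec_sandwich linearB !linearZ/=.
have /(canRL (addrK _)) -> := clvec_relation y w.
rewrite mulrBl -mulrA clvec_sqr mulr_algl mulr_algr.
by rewrite mulNr !scaleNr scalerN opprK addrC.
Qed.

Lemma cle_clvec_cle i y :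
  cle R i * clvec y * cle R i = clvec y - (2 * y 0 i) *: cle R i.
Proof.
have /(canRL (addrK _)) := clvec_relation y (delta_mx 0 i).
rewrite clvec_delta dotp_delta -mulrA => ->.
by rewrite mulrBr mulrA cle_sqr mulN1r opprK mulr_algr mulNr scaleNr addrC.
Qed.

(** * Differentials and gradients *)

Lemma clifford_mul_is_bilinear : bilinear_for *:%R *:%R (@GRing.mul Cl).
Proof.
split=> [b|a] k x y /=; first by rewrite mulrDl scalerAl.
by rewrite mulrDr scalerAr.
Qed.

Lemma clifford_mul_continuous : continuous (fun p : Cl * Cl => p.1 * p.2).
Proof.
apply: (continuous_big (@add_continuous Cl)) => A _.
apply: (continuous_big (@add_continuous Cl)) => B _ p.
have coefC (X : {set 'I_m}) (c : Cl) : {for c, continuous (fun a : Cl => clcoef a X)}.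
  exact: (@coord_continuous R).
pose k (q : Cl * Cl) : R := clcoef q.1 A * clcoef q.2 B.
have kC : {for p, continuous k}.
  apply: (@continuousM R _ (fun q : Cl * Cl => clcoef q.1 A) (fun q => clcoef q.2 B)).
    exact: (@continuous_comp _ _ _ fst (fun a : Cl => clcoef a A) p cvg_fst (coefC _ _)).
  exact: (@continuous_comp _ _ _ snd (fun a : Cl => clcoef a B) p cvg_snd (coefC _ _)).
apply: (@continuousZr_tmp R Cl _ (fun q => k q * clsign R A B)).
by apply: cvgM => //; exact: cvg_cst.
Qed.

Lemma is_diff_clifford_mul (U : normedModType R) (f df g dg : U -> Cl) (x : U) :
  is_diff x f df -> is_diff x g dg ->
  is_diff x (fun z => f z * g z) (fun v => f x * dg v + df v * g x).
Proof.
pose BM :=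
  bilinear_isBilinear.Build R Cl Cl Cl *:%R *:%R *%R clifford_mul_is_bilinear.
pose B : {bilinear Cl -> Cl -> Cl} := HB.pack (@GRing.mul Cl) BM.
exact: (@is_diff_bilinear R U _ _ _ B _ _ _ _ _ clifford_mul_continuous).
Qed.

Lemma is_diff_clvec x : is_diff x (@clvec R m) (@clvec R m).
Proof. by apply: is_diff_linear_rV => k u v; rewrite linearP. Qed.

Lemma is_diff_clvecMr c y :
  is_diff y (fun z => clvec z * c) (fun h => clvec h * c).
Proof.
by apply: is_diff_linear_rV => k u v; rewrite linearP mulrDl scalerAl.
Qed.

(** [z.z] is minus the scalar part of the Clifford square [z z], so the product rule
    and the polarized relation [x h + h x = - 2 (x.h)] give its gradient. *)
Lemma is_diff_dotp_sqr x : is_diff x (fun z => dotp z z) (dotp (2 *: x)).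
Proof.
have sqrE (u : 'rV[R]_m) : dotp u u = - clcoef (clvec u * clvec u) finset.set0.
  by rewrite clvec_sqr clcoef_alg enorm_sqr opprK.
have coefL : linear (fun a : Cl => - clcoef a finset.set0).
  by move=> k a b; rewrite clcoefD clcoefZ opprD scalerN.
have D := is_diff_comp (is_diff_clifford_mul (is_diff_clvec x) (is_diff_clvec x))
  (is_diff_linear_rV _ coefL).
rewrite (funext sqrE); apply: is_diff_eq D _; apply/funext => h /=.
by rewrite clvec_relation clcoef_alg mulNr opprK dotpZl.
Qed.

Lemma is_diff_enorm y :
  y != 0 -> is_diff y (@enorm R m) (dotp ((enorm y)^-1 *: y)).
Proof.
move=> y0; have ny := enorm_gt0 y0.
have yy : 0 < dotp y y by rewrite -enorm_sqr exprn_gt0.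
have sD : is_diff (dotp y y) Num.sqrt (fun s : R => s / (2 * enorm y)).
  have dS := is_derive1_sqrt yy.
  have dsqrt : differentiable Num.sqrt (dotp y y).
    by apply/derivable1_diffP; exact: ex_derive.
  apply: DiffDef => //; rewrite diff1E//.
  by apply/funext => s; rewrite derive1E derive_val.
apply: is_diff_eq (is_diff_comp (is_diff_dotp_sqr y) sD) _.
by apply/funext => h /=; rewrite !dotpZl; field; rewrite gt_eqF.
Qed.

Lemma is_diff_enormVX n y : y != 0 ->
  is_diff y (fun z => (enorm z ^+ n)^-1)
    (dotp (- (n%:R * (enorm y ^+ (n + 2))^-1) *: y)).
Proof.
move=> y0; have ny : enorm y != 0 by rewrite gt_eqF ?enorm_gt0.
case: n => [|n].
  have -> : (fun z : 'rV[R]_m => (enorm z ^+ 0)^-1) = cst 1.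
    by apply/funext => z; rewrite expr0 invr1.
  apply: is_diff_eq (is_diff_cst (1 : R) y) _.
  by apply/funext => h; rewrite dotpZl mul0r oppr0 mul0r.
have pD := is_diffX n (is_diff_enorm y0).
have pn : (@enorm R m ^+ n.+1) y != 0 by rewrite exprfctE expf_neq0.
have dp : differentiable (@enorm R m ^+ n.+1) y by exact: ex_diff.
have -> : (fun z => (enorm z ^+ n.+1)^-1) = (fun z => ((@enorm R m ^+ n.+1) z)^-1).
  by apply/funext => z; rewrite exprfctE.
apply: DiffDef; first exact: (differentiableV dp pn).
rewrite (diffV dp pn) diff_val exprfctE; apply/funext => h /=.
transitivity (- (enorm y ^+ n.+1) ^- 2 *
  (n.+1%:R * enorm y ^+ n * dotp ((enorm y)^-1 *: y) h)); first by [].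
rewrite !dotpZl exprD !exprS; field.
by rewrite ny expf_neq0.
Qed.

Lemma is_diff_gradM (k l : 'rV[R]_m -> R) gk gl y :
  is_diff y k (dotp gk) -> is_diff y l (dotp gl) ->
  is_diff y (fun z => k z * l z) (dotp (l y *: gk + k y *: gl)).
Proof.
move=> kD lD; apply: is_diff_eq (is_diffM kD lD) _.
by apply/funext => h /=; rewrite dotpDl !dotpZl [RHS]addrC.
Qed.

(** * The Dirac operator *)

Lemma dirac_is_diff (f df : 'rV[R]_m -> Cl) x :
  is_diff x f df -> dirac f x = \sum_i cle R i * df (delta_mx 0 i).
Proof.
move=> fx; apply: eq_bigr => i _; congr (_ * _).
by rewrite deriveE ?diff_val//; apply: ex_diff.
Qed.

Lemma dirac_scale (k : 'rV[R]_m -> R) (f : 'rV[R]_m -> Cl) g y :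
  is_diff y k (dotp g) -> differentiable f y ->
  dirac (fun z => k z *: f z) y = clvec g * f y + k y *: dirac f y.
Proof.
move=> dk df; rewrite (dirac_is_diff (is_diff_scale dk (differentiableP df))).
rewrite (dirac_is_diff (differentiableP df)) scaler_sumr /clvec mulr_suml -big_split.
apply: eq_bigr => i _ /=.
by rewrite mulrDr dotp_delta -!scalerAr -scalerAl addrC.
Qed.

Lemma dirac_subZ (f g : 'rV[R]_m -> Cl) (k : R) y :
  differentiable f y -> differentiable g y ->
  dirac (fun z => f z - k *: g z) y = dirac f y - k *: dirac g y.
Proof.
move=> /differentiableP df /differentiableP dg.
rewrite (dirac_is_diff (is_diffB df (is_diffZ k dg))).
rewrite (dirac_is_diff df) (dirac_is_diff dg) scaler_sumr -sumrB.
by apply: eq_bigr => i _; rewrite mulrBr -scalerAr.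
Qed.

Lemma dirac_cst c y : dirac (fun=> c) y = 0.
Proof.
by rewrite (dirac_is_diff (is_diff_cst c y)) big1// => i _; rewrite mulr0.
Qed.

Lemma dirac_clvecMr c y : dirac (fun z => clvec z * c) y = - m%:R *: c.
Proof.
rewrite (dirac_is_diff (is_diff_clvecMr c y)).
under eq_bigr => i _ do rewrite clvec_delta mulrA cle_sqr mulN1r.
by rewrite sumr_const card_ord mulNrn scaleNr scaler_nat.
Qed.

Lemma differentiable_kernel_const c y : y != 0 ->
  differentiable (fun z => (enorm z ^+ m)^-1 *: (clvec z * c)) y.
Proof.
move=> y0; have D := is_diff_scale (is_diff_enormVX m y0) (is_diff_clvecMr c y).
exact: ex_diff.
Qed.

(** For an exponent [n], [(grad |z|^-n) z = - n |z|^-(n+2) z z = n |z|^-n], while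
    [|z|^-n D z = - m |z|^-n]: the sum vanishes for [n = m]. *)
Lemma dirac_kernel_const c y : y != 0 ->
  dirac (fun z => (enorm z ^+ m)^-1 *: (clvec z * c)) y = 0.
Proof.
move=> y0.
rewrite (dirac_scale (is_diff_enormVX m y0)) ?dirac_clvecMr; last first.
  by have D := is_diff_clvecMr c y; exact: ex_diff.
rewrite linearZ/= -scalerAl mulrA clvec_sqr mulr_algl !scalerA -scalerDl.
rewrite mulrNN -mulrA enormVX2//.
by rewrite mulrN [_ * m%:R]mulrC subrr scale0r.
Qed.

End CliffordCalculus.

(** * Inversion of the saddle field *)

Section Saddle.
Variables (R : realType) (m : nat) (i j : 'I_m).
Local Notation Cl := (clifford R m).
Implicit Types (x y w u : 'rV[R]_m).

Definition saddle u : Cl := u 0 i *: cle R i - u 0 j *: cle R j.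

Lemma saddle_linear : linear saddle.
Proof.
move=> k u v; rewrite /saddle !mxE scalerBr !scalerA !scalerDl.
by rewrite opprD addrACA.
Qed.

HB.instance Definition _ :=
  GRing.isLinear.Build R 'rV[R]_m (clifford R m) *:%R saddle saddle_linear.

Lemma saddle_delta k :
  saddle (delta_mx 0 k) = (k == i)%:R *: cle R i - (k == j)%:R *: cle R j.
Proof. by rewrite /saddle !mxE eqxx/= ![_ == k]eq_sym. Qed.

Lemma polynomial_saddle : polynomial_map saddle.
Proof.
exists (fun A =>
  clcoef (cle R i) A *: mpoly.mpolyX R (mpoly.mnm1 i)
  - clcoef (cle R j) A *: mpoly.mpolyX R (mpoly.mnm1 j)) => u A.
rewrite mpoly.mevalB !mpoly.mevalZ !mpoly.mevalXU.
by rewrite /saddle -scaleNr clcoefD !clcoefZ mulNr ![clcoef _ A * _]mulrC.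
Qed.

Lemma is_diff_saddle u : is_diff u saddle saddle.
Proof. exact: is_diff_linear_rV saddle_linear. Qed.

Lemma sum_delta_scale (k : 'I_m) (F : 'I_m -> Cl) :
  \sum_l (l == k)%:R *: F l = F k.
Proof.
rewrite (bigD1 k)//= eqxx scale1r big1 ?addr0// => l /negbTE ->.
by rewrite scale0r.
Qed.

Lemma dirac_saddle u : dirac saddle u = 0.
Proof.
rewrite (dirac_is_diff (is_diff_saddle u)).
under eq_bigr => k _ do rewrite saddle_delta mulrBr -!scalerAr.
by rewrite sumrB !sum_delta_scale !cle_sqr subrr.
Qed.

Lemma is_diff_clvec_saddle y : is_diff y (fun z => clvec z * saddle z)
  (fun h => clvec y * saddle h + clvec h * saddle y).
Proof. exact: is_diff_clifford_mul (is_diff_clvec y) (is_diff_saddle y). Qed.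

(** Differentiating the left factor gives [- m tau(y)]; differentiating the right
    one gives [e_i y e_i - e_j y e_j], which is [- 2 tau(y)]. *)
Lemma dirac_clvec_saddle y :
  dirac (fun z => clvec z * saddle z) y = - (m + 2)%:R *: saddle y.
Proof.
rewrite (dirac_is_diff (is_diff_clvec_saddle y)).
under eq_bigr => k _ do rewrite mulrDr.
rewrite big_split/=.
have := dirac_clvecMr (saddle y) y.
rewrite (dirac_is_diff (is_diff_clvecMr _ _)) => ->.
under eq_bigr => k _ do rewrite saddle_delta !mulrBr -!scalerAr !mulrA.
rewrite sumrB !sum_delta_scale !cle_clvec_cle.
rewrite natrD [in RHS]opprD [in RHS]scalerDl [LHS]addrC; congr (_ + _).
by rewrite /saddle opprB addrC addrA subrK scaleNr scalerBr opprB !scalerA.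
Qed.

Lemma inversion_saddle w y :
  inversion (fun=> saddle) w y =
    (enorm y ^+ m)^-1 *: (clvec y * saddle w)
    - 2 *: ((dotp w y * (enorm y ^+ (m + 2))^-1) *: (clvec y * saddle y)).
Proof.
rewrite /inversion sandwichE [dotp y w]dotpC.
(* At y = 0 both sides vanish because of the factor clvec y. *)
have [->|y0] := eqVneq y 0.
  by rewrite linear0 !mul0r !scaler0 subr0.
have ny : enorm y != 0 by rewrite gt_eqF ?enorm_gt0.
rewrite scalerBr !scalerA mulVf ?expf_neq0// scale1r linearB linearZ/=.
rewrite mulrBr scalerBr -scalerAr !scalerA; congr (_ - _ *: _).
by rewrite exprD; field; rewrite ny expf_neq0.
Qed.

Lemma is_diff_dotp_enormVX n w y : y != 0 ->
  is_diff y (fun z => dotp w z * (enorm z ^+ n)^-1)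
    (dotp ((enorm y ^+ n)^-1 *: w
           + dotp w y *: (- (n%:R * (enorm y ^+ (n + 2))^-1) *: y))).
Proof.
move=> y0; apply: is_diff_gradM (is_diff_enormVX n y0).
exact: is_diff_linear_rV (dotp_linear w).
Qed.

Lemma differentiable_kernel_saddle w y : y != 0 ->
  differentiable
    (fun z => (dotp w z * (enorm z ^+ (m + 2))^-1) *: (clvec z * saddle z)) y.
Proof.
move=> y0.
have D := is_diff_scale (is_diff_dotp_enormVX (m + 2) w y0) (is_diff_clvec_saddle y).
exact: ex_diff.
Qed.

Lemma dirac_kernel_saddle w y : y != 0 ->
  dirac (fun z => (dotp w z * (enorm z ^+ (m + 2))^-1) *: (clvec z * saddle z)) y
  = (enorm y ^+ (m + 2))^-1 *: (clvec w * clvec y * saddle y).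
Proof.
move=> y0.
rewrite (dirac_scale (is_diff_dotp_enormVX _ w y0)) ?dirac_clvec_saddle; last first.
  by have D := is_diff_clvec_saddle y; exact: ex_diff.
rewrite linearD !(linearZ_LR (@clvec R m))/= mulrDl -!scalerAl !mulrA.
rewrite clvec_sqr mulr_algl !scalerA -addrA -scalerDl.
(* The radial part of the gradient cancels D (z tau(z)). *)
rewrite [X in _ + X *: _](_ : _ = 0) ?scale0r ?addr0//.
by rewrite -[in X in _ + X](enormVX2 _ y0); ring.
Qed.

Lemma differentiable_inversion_saddle w y :
  y != 0 -> differentiable (inversion (fun=> saddle) w) y.
Proof.
move=> y0; rewrite (funext (inversion_saddle w)).
have D1 := differentiableP (differentiable_kernel_const (saddle w) y0).
have D2 := differentiableP (differentiable_kernel_saddle w y0).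
have D := is_diffB D1 (is_diffZ 2 D2).
exact: ex_diff.
Qed.

Lemma dirac_inversion_saddle w y : y != 0 ->
  dirac (inversion (fun=> saddle) w) y =
    (enorm y ^+ (m + 2))^-1 *: (- 2 *: (clvec w * clvec y * saddle y)).
Proof.
move=> y0; rewrite (funext (inversion_saddle w)) dirac_subZ.
- rewrite dirac_kernel_const// dirac_kernel_saddle// sub0r.
  by rewrite -scaleNr !scalerA mulrC.
- exact: differentiable_kernel_const.
- exact: differentiable_kernel_saddle.
Qed.

Lemma saddle_counterexample : i != j -> inversion_counterexample (fun=> saddle).
Proof.
move=> ij; split.
- by move=> _; exact: polynomial_saddle.
- by move=> u x; split; [exact: differentiable_cst|exact: dirac_cst].
- move=> _ u; split; last exact: dirac_saddle.
  by have D := is_diff_saddle u; exact: ex_diff.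
- by move=> w y; exact: differentiable_inversion_saddle.
- have y0 : delta_mx 0 i != 0 :> 'rV[R]_m.
    apply/eqP => /rowP /(_ i) /eqP.
    by rewrite !mxE !eqxx oner_eq0.
  exists (delta_mx 0 i), (delta_mx 0 i); split => //.
  rewrite dirac_inversion_saddle// clvec_delta cle_sqr saddle_delta eqxx (negbTE ij).
  rewrite scale1r scale0r subr0 mulN1r !scaler_eq0 invr_eq0 expf_eq0 enorm_eq0.
  rewrite (negbTE y0) andbF oppr_eq0 pnatr_eq0 oppr_eq0/=.
  apply/eqP => /(congr1 (fun a => clcoef a [set i]%SET)) /eqP.
  by rewrite clcoef_blade eqxx clcoef0 oner_eq0.
Qed.

End Saddle.

Unset Implicit Arguments.
Set Strict Implicit.

Theorem mainTheorem4 (R : realType) (m : nat) (hm : (2 < m)%N) :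
  let i1 : 'I_m := Ordinal (ltnW (ltnW hm)) in
  let i2 : 'I_m := Ordinal (ltnW hm) in
  let f0 : 'rV[R]_m -> 'rV[R]_m -> clifford R m :=
    fun x u => u 0 i1 *: cle R i1 - u 0 i2 *: cle R i2 in
  (exists f : 'rV[R]_m -> 'rV[R]_m -> clifford R m, inversion_counterexample f)
  /\ inversion_counterexample f0
  /\ (forall w y : 'rV[R]_m, y != 0 ->
        dirac (inversion f0 w) y =
        (enorm y ^+ (m + 2))^-1 *:
          (- 2 *: (clvec w * clvec y *
                   (y 0 i1 *: cle R i1 - y 0 i2 *: cle R i2)))).
Proof.
move=> i1 i2 f0.
have f0P : inversion_counterexample f0 by exact: saddle_counterexample.
split; first by exists f0.
by split => // w y; exact: dirac_inversion_saddle.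
Qed.
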